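(* Let $1\le r\le 2$, let $E$ be a Banach space over $\mathbb{K}$ and let $C>0$. Suppose that $\mathcal{L}({}^2E;\mathbb{K})=\Pi_{(1;r,r)}({}^2E;\mathbb{K})$ and $\pi_{(1;r,r)}\le C\|\cdot\|$. Then: (i) For every even positive integer $n$, $\mathcal{L}({}^nE;\mathbb{K})=\Pi_{(1;r,\dots,r)}({}^nE;\mathbb{K})$ and $\pi_{(1;r,\dots,r)}\le C^{n/2}\|\cdot\|$. (ii) For every odd $n\ge3$, $\mathcal{L}({}^nE;\mathbb{K})=\Pi_{(r;r,\dots,r)}({}^nE;\mathbb{K})$ and $\pi_{(r;r,\dots,r)}\le C^{(n-1)/2}\|\cdot\|$.
   Context: $\mathbb{K}=\mathbb{R}$ or $\mathbb{C}$. $\mathcal{L}({}^nE;\mathbb{K})$ is the Banach space of continuous $n$-linear forms on $E\times\cdots\times E$ ($n$ factors) with the sup norm $\|\cdot\|$. With $B_{E'}$ the closed unit ball of the dual $E'$, $\|(x_j)_j\|_{\ell_p^w(E)}=\sup_{\varphi\in B_{E'}}(\sum_j|\varphi(x_j)|^p)^{1/p}$. For $\frac1p\le\frac1{p_1}+\cdots+\frac1{p_n}$, $\Pi_{(p;p_1,\dots,p_n)}({}^nE;\mathbb{K})$ is the space of absolutely $(p;p_1,\dots,p_n)$-summing forms, i.e. those $A$ for which there is $C>0$ with $\|(A(x_j^1,\dots,x_j^n))_j\|_p\le C\prod_{i=1}^n\|(x_j^i)_j\|_{\ell_{p_i}^w(E)}$ for all finite families $(x^i_j)_j$ in $E$;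 $\pi_{(p;p_1,\dots,p_n)}(A)$ is the infimum of such $C$. *)

(* Defs.v *)
From HB Require Import structures.
From mathcomp Require Import all_boot all_order all_algebra complex.
From mathcomp Require Import all_classical all_reals all_analysis.
Set Implicit Arguments.
Unset Strict Implicit.
Unset Printing Implicit Defensive.
Import Order.TTheory GRing.Theory Num.Theory.
Import numFieldNormedType.Exports.
Local Open Scope classical_set_scope.
Local Open Scope ring_scope.

Inductive scalars := RealScalars | ComplexScalars.

Definition scalar_field (R : realType) (s : scalars) : numFieldType :=
  match s with RealScalars => R | ComplexScalars => R[i] end.

(* The norm of a numFieldType takes its values in that field, so over R[i] the
   modulus `|z| is an element of R[i] with zero imaginary part.  modulus is the
   same absolute value, with values in R. *)
Definition modulus (R : realType) (s : scalars) : scalar_field R s -> R :=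
  match s return scalar_field R s -> R with
  | RealScalars => fun x : R => `|x|
  | ComplexScalars => fun z : R[i] => complex.Re `|z|
  end.

Section SummingForms.
Context {R : realType} {s : scalars}.
Local Notation K := (scalar_field R s).

Definition lp_norm (p : R) (m : nat) (a : 'I_m -> K) : R :=
  (\sum_(j < m) modulus (a j) `^ p) `^ p^-1.

Section Space.
Variable E : completeNormedModType K.

Definition multilinear (n : nat) (A : ('I_n -> E) -> K) : Prop :=
  forall (x : 'I_n -> E) (i : 'I_n),
    linear (fun y : E => A (dfwith x i y) : K^o).

Definition cont_forms (n : nat) : set (('I_n -> E) -> K) :=
  [set A | multilinear A /\ continuous (A : {ptws 'I_n -> E} -> K)].

(* The set is nonempty, and bounded whenever A is a continuous form, so that
   the real-valued sup is the genuine supremum; the same remark applies to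
   dual_norm on continuous functionals and to weak_norm. *)
Definition form_norm (n : nat) (A : ('I_n -> E) -> K) : R :=
  sup [set modulus (A x) | x in [set x | forall i, `|x i| <= 1]].

Definition dual_norm (phi : E -> K) : R :=
  sup [set modulus (phi y) | y in [set y | `|y| <= 1]].

Definition dual_ball : set (E -> K) :=
  [set phi | [/\ linear (phi : E -> K^o), continuous phi & dual_norm phi <= 1]].

Definition weak_norm (p : R) (m : nat) (x : 'I_m -> E) : R :=
  sup [set lp_norm p (fun j => phi (x j)) | phi in dual_ball].

(* x i j is the j-th vector of the i-th family. *)
Definition summing_consts (n : nat) (p : R) (q : 'I_n -> R)
    (A : ('I_n -> E) -> K) : set R :=
  [set c | 0 < c /\ forall (m : nat) (x : 'I_n -> 'I_m -> E),
     lp_norm p (fun j => A (fun i => x i j))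
     <= c * \prod_(i < n) weak_norm (q i) (x i)].

Definition summing_forms (n : nat) (p : R) (q : 'I_n -> R)
    : set (('I_n -> E) -> K) :=
  [set A | cont_forms A /\ summing_consts p q A !=set0].

(* Meaningful for A in summing_forms p q: the inf of the empty set is 0. *)
Definition summing_norm (n : nat) (p : R) (q : 'I_n -> R)
    (A : ('I_n -> E) -> K) : R :=
  inf (summing_consts p q A).

End Space.
End SummingForms.

Arguments cont_forms {R s} E n.
Arguments summing_forms {R s} E n p q.

(* Main.v *)
(** The case [n + 2] is obtained from the cases [n] and [2] by averaging over
    signs.  Given families [z_k] in [E^2] and [v_j] in [E^n], put, for each sign
    vector [e],
      [B_e(y) = \sum_k e_k A(z_k, y)].
    The bilinear hypothesis applied to [A(., y)] bounds [\sum_k |A(z_k, y)|]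
    uniformly in the unit vectors [y], hence it bounds the norm of the n-linear
    form [B_e].  Orthogonality of the signs gives
    [A(z_j, v_j) = E_e(e_j B_e(v_j))], so by the power mean inequality
    [\sum_j |A(z_j, v_j)|^p <= E_e(\sum_j |B_e(v_j)|^p)], which is controlled by
    the case [n].  Even degrees start from the hypothesis with [p = 1], odd
    degrees from linear functionals, which are [(r; r)]-summing with constant 1
    by definition of the weak norm. *)

Require Import Defs.
From HB Require Import structures.
From mathcomp Require Import all_boot all_order all_algebra complex.
From mathcomp Require Import all_classical all_reals all_analysis.
From mathcomp Require Import ring.
Import Order.TTheory GRing.Theory Num.Theory.
Import numFieldNormedType.Exports.
Local Open Scope classical_set_scope.
Local Open Scope ring_scope.

(** * Real-valued absolute value on the scalars *)

Section Modulus.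
Local Set Implicit Arguments.
Local Unset Strict Implicit.
Context {R : realType} {s : scalars}.
Local Notation K := (scalar_field R s).
Implicit Types x y : K.

(** This ordered embedding of [R] in [K] carries facts about the [K]-valued norm over to
    [modulus]. *)
Definition real_scalar : R -> K :=
  match s return R -> scalar_field R s with
  | RealScalars => id
  | ComplexScalars => fun a => a%:C%C
  end.

Lemma norm_modulus x : `|x| = real_scalar (modulus x).
Proof.
by rewrite /real_scalar; case: s x.
Qed.

Lemma ler_real_scalar (a b : R) : (real_scalar a <= real_scalar b) = (a <= b).
Proof. by rewrite /real_scalar; case: s => //=; rewrite lecR. Qed.

Lemma real_scalarD : {morph real_scalar : a b / a + b}.
Proof. by move=> a b; rewrite /real_scalar; case: s => //=; rewrite rmorphD. Qed.

Lemma real_scalarM : {morph real_scalar : a b / a * b}.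
Proof. by move=> a b; rewrite /real_scalar; case: s => //=; rewrite rmorphM. Qed.

Lemma real_scalar0 : real_scalar 0 = 0.
Proof. by rewrite /real_scalar; case: s. Qed.

Lemma real_scalar1 : real_scalar 1 = 1.
Proof. by rewrite /real_scalar; case: s. Qed.

Lemma real_scalar_inj : injective real_scalar.
Proof.
by move=> a b ab; apply/eqP; rewrite eq_le -!ler_real_scalar ab lexx.
Qed.

Lemma modulus_ge0 x : 0 <= modulus x.
Proof. by rewrite -ler_real_scalar real_scalar0 -norm_modulus. Qed.

Lemma modulusM x y : modulus (x * y) = modulus x * modulus y.
Proof.
by apply: real_scalar_inj; rewrite real_scalarM -!norm_modulus normrM.
Qed.

Lemma modulusD x y : modulus (x + y) <= modulus x + modulus y.
Proof. by rewrite -ler_real_scalar real_scalarD -!norm_modulus ler_normD. Qed.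

Lemma modulus0 : modulus (0 : K) = 0.
Proof. by apply: real_scalar_inj; rewrite -norm_modulus normr0 real_scalar0. Qed.

Lemma modulus0_eq0 x : modulus x = 0 -> x = 0.
Proof.
by move=> x0; apply/eqP; rewrite -normr_eq0 norm_modulus x0 real_scalar0.
Qed.

Lemma modulus_real_scalar (a : R) : 0 <= a -> modulus (real_scalar a) = a.
Proof.
move=> a0; apply: real_scalar_inj; rewrite -norm_modulus ger0_norm //.
by rewrite -real_scalar0 ler_real_scalar.
Qed.

Lemma modulus_sign (b : bool) : modulus ((-1) ^+ b : K) = 1.
Proof.
by apply: real_scalar_inj; rewrite -norm_modulus normr_sign real_scalar1.
Qed.

Lemma modulus_natr (n : nat) : modulus (n%:R : K) = n%:R.
Proof.
rewrite -[n%:R in LHS](_ : real_scalar n%:R = _) ?modulus_real_scalar//.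
by rewrite /real_scalar; case: s => //=; rewrite rmorph_nat.
Qed.

Lemma modulus_sum (I : Type) (e : seq I) (P : pred I) (F : I -> K) :
  modulus (\sum_(i <- e | P i) F i) <= \sum_(i <- e | P i) modulus (F i).
Proof.
elim/big_ind2: _ => [|x a y b xa yb|//]; first by rewrite modulus0.
exact: le_trans (modulusD _ _) (lerD xa yb).
Qed.

End Modulus.

(** * Convexity of powers *)

Section PowerMean.
Local Set Implicit Arguments.
Local Unset Strict Implicit.
Context {R : realType}.

(* For the empty list both sides are [0], since [0 / 0 = 0] and [p != 0]. *)
Lemma power_mean (p : R) (I : Type) (e : seq I) (F : I -> R) :
  1 <= p -> (forall i, 0 <= F i) ->
  ((\sum_(i <- e) F i) / (size e)%:R) `^ p
    <= (\sum_(i <- e) F i `^ p) / (size e)%:R.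
Proof.
move=> p1 F0; have p0 : p != 0 by rewrite gt_eqF // (lt_le_trans ltr01).
elim: e => [|i e IH]; first by rewrite !big_nil !mul0r powR0.
rewrite !big_cons /=; set N := size e in IH *.
have N0 : 0 <= N.+1%:R^-1 :> R by rewrite invr_ge0.
have N1 : N.+1%:R^-1 <= 1 :> R by rewrite invf_le1 ?ler1n.
pose t := Itv01 N0 N1.
(* The mean of [N.+1] terms is a convex combination of the head, with weight [t = N.+1%:R^-1], and
   the mean of the tail. For [N = 0] the latter reads [b / 0 = 0], so [b] must vanish. *)
have avg (a b : R) : (N = 0%N -> b = 0) ->
    (a + b) / N.+1%:R = (t%:num : R) * a + (1 - t%:num) * (b / N%:R).
  move=> b0; rewrite /=; case: (eqVneq N 0%N) => [N0'|NN0].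
    by rewrite b0 // N0' addr0 mul0r mulr0 addr0 mulrC.
  rewrite mulrDl [a / _]mulrC; congr (_ + _).
  have -> : 1 - N.+1%:R^-1 = N%:R / N.+1%:R :> R.
    by rewrite -natr1; field; rewrite natr1 pnatr_eq0.
  by rewrite -natr1; field; rewrite ?natr1 ?nat1r !pnatr_eq0 ?NN0.
have nil0 (G : I -> R) : N = 0%N -> \sum_(j <- e) G j = 0.
  by move/size0nil => ->; rewrite big_nil.
rewrite !avg; [|exact: nil0..].
have pos_avg : 0 <= (\sum_(j <- e) F j) / N%:R.
  by rewrite mulr_ge0 ?invr_ge0// sumr_ge0.
have := @convex_powR R p p1 t (F i) ((\sum_(j <- e) F j) / N%:R).
rewrite !inE /= !in_itv /= !andbT => /(_ (F0 i) pos_avg).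
move=> /le_trans; apply.
by rewrite lerD2l ler_wpM2l // subr_ge0.
Qed.

End PowerMean.

(** * Finite l_p norms *)

Section Lp.
Local Set Implicit Arguments.
Local Unset Strict Implicit.
Context {R : realType} {s : scalars}.
Local Notation K := (scalar_field R s).

Lemma lp_norm_ge0 (p : R) m (a : 'I_m -> K) : 0 <= lp_norm p a.
Proof. exact: powR_ge0. Qed.

Lemma lp_norm1 m (a : 'I_m -> K) : lp_norm 1 a = \sum_j modulus (a j).
Proof.
rewrite /lp_norm invr1 powRr1.
  by apply: eq_bigr => j _; rewrite powRr1 // modulus_ge0.
by apply: sumr_ge0 => j _; exact: powR_ge0.
Qed.

(** Removing the outer root leaves an expression additive in [j], which can be averaged and
    exchanged with other sums. *)
Lemma lp_norm_le_sum (p c : R) m (a : 'I_m -> K) : 0 < p -> 0 <= c ->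
  (lp_norm p a <= c) = (\sum_j modulus (a j) `^ p <= c `^ p).
Proof.
move=> p0 c0; set S := \sum_j _.
have S0 : 0 <= S by apply: sumr_ge0 => j _; exact: powR_ge0.
apply/idP/idP => [ac|Sc].
  have -> : S = lp_norm p a `^ p.
    by rewrite /lp_norm -powRrM mulVf ?gt_eqF// powRr1.
  by rewrite ge0_ler_powR ?nnegrE ?lp_norm_ge0 // ltW.
have -> : c = (c `^ p) `^ p^-1 by rewrite -powRrM mulfV ?gt_eqF// powRr1.
by rewrite ge0_ler_powR ?nnegrE ?powR_ge0 // invr_ge0 ltW.
Qed.

Lemma lp_normZ (p : R) m (c : K) (a : 'I_m -> K) : 0 < p ->
  lp_norm p (fun j => c * a j) = modulus c * lp_norm p a.
Proof.
move=> p0; rewrite /lp_norm.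
under eq_bigr do rewrite modulusM powRM ?modulus_ge0//.
rewrite -mulr_sumr powRM ?powR_ge0 ?sumr_ge0//; last by move=> *; exact: powR_ge0.
by rewrite -powRrM mulfV ?gt_eqF// powRr1 // modulus_ge0.
Qed.

End Lp.

(** * Continuous multilinear forms and their norm *)

Section Forms.
Local Set Implicit Arguments.
Local Unset Strict Implicit.
Context {R : realType} {s : scalars} (E : completeNormedModType (scalar_field R s)).
Local Notation K := (scalar_field R s).

(** The topology is the supremum of those induced by the coordinates. Constant families show that
    each evaluation is onto, as [cvg_image] requires. *)
Lemma cvg_ptws n (F : set_system ('I_n -> E)) (f : 'I_n -> E) : Filter F ->
  (forall i, (fun g => g i) @ F --> f i) -> F --> (f : {ptws 'I_n -> E}).
Proof.
move=> FF cv; apply/cvg_sup => i; apply/cvg_image.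
  by rewrite eqEsubset; split=> v // _; exists (cst v).
move=> W fW; exists ((fun g : 'I_n -> E => g i) @^-1` W); first exact: cv.
by rewrite eqEsubset; split=> [_ [g Wg <-]//|v Wv]; exists (cst v).
Qed.

Lemma continuous_ptws (T : topologicalType) n (f : T -> 'I_n -> E) :
  (forall i, continuous (fun t => f t i)) ->
  continuous (f : T -> {ptws 'I_n -> E}).
Proof. by move=> fc t; apply: cvg_ptws => i; exact: fc. Qed.

Lemma multilinearZ n (A : ('I_n -> E) -> K) (c : K) (x : 'I_n -> E) :
  multilinear A -> A (fun i => c *: x i) = c ^+ n * A x.
Proof.
move=> Al.
have Z (y : 'I_n -> E) i v : A (dfwith y i (c *: v)) = c * A (dfwith y i v).
  have l := Al y i.
  have A0 : A (dfwith y i 0) = 0.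
    (* Linearity at zero vectors reads [A0 = A0 + A0]. *)
    have /esym/eqP := l 1 0 0.
    by rewrite scaler0 addr0 scale1r -subr_eq0 addrK => /eqP.
  by have := l c v 0; rewrite addr0 A0 addr0.
(* Scale the coordinates one at a time. *)
suff H e : uniq e ->
    A (fun i => if i \in e then c *: x i else x i) = c ^+ size e * A x.
  have := H (enum 'I_n) (enum_uniq _); rewrite size_enum_ord => <-.
  by congr A; apply/funext => i; rewrite mem_enum.
elim: e => [_|i e IH /= /andP[ie ue]]; first by rewrite mul1r; congr A.
rewrite exprS -mulrA -IH //.
set y := fun j => if j \in e then _ else _.
have -> : (fun j => if j \in i :: e then c *: x j else x j) = dfwith y i (c *: y i).
  apply/funext => j; rewrite inE; have [->|ji] := eqVneq j i.
    by rewrite dfwithin /y (negbTE ie).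
  by rewrite dfwithout // eq_sym.
rewrite Z; congr (_ * A _); apply/funext => j.
by case: dfwithP.
Qed.

(** Continuity at 0 keeps [A] within 1 of [A (cst 0)] on some polyball of radius [d], and
    homogeneity of degree [n] rescales it to the unit one. The value [A (cst 0)] stays in the bound
    because it need not vanish when [n = 0]. *)
Lemma cont_form_bounded n (A : ('I_n -> E) -> K) : cont_forms E n A ->
  has_ubound [set modulus (A x) | x in [set x | forall i, `|x i| <= 1]].
Proof.
move=> [Al Ac].
(* The filter generated by polyballs of real radius converges to 0, and composing it with [A] yields
   the radius [d] directly. *)
pose F := filter_from [set d : R | 0 < d]
  (fun d => [set x : 'I_n -> E | forall i, `|x i| <= real_scalar d]).
have FF : Filter F.
  apply: filter_from_filter; first by exists 1 => /=.
  move=> d e /= d0 e0; exists (Num.min d e); first by rewrite /= lt_min d0.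
  move=> x /= xde; split=> i; apply: (le_trans (xde i));
    by rewrite ler_real_scalar ge_min lexx ?orbT.
have F0 : F --> (cst 0 : {ptws 'I_n -> E}).
  apply: cvg_ptws => i; apply/cvgr0Pnorm_le => e e0.
  (* A positive [e] in [K] equals its own norm, so its modulus is a real radius. *)
  exists (modulus e); last by move=> x /= /(_ i); rewrite -norm_modulus gtr0_norm.
  rewrite /= lt_def modulus_ge0 andbT; apply/eqP => /modulus0_eq0 e0'.
  by rewrite e0' ltxx in e0.
have /cvgrPdist_le/(_ 1 ltr01)[d /= d0 dA] := cvg_trans (cvg_app A F0) (Ac (cst 0)).
exists ((modulus (A (cst 0)) + 1) / d ^+ n) => _ [x /= x1 <-].
rewrite ler_pdivlMr ?exprn_gt0//.
have -> : d ^+ n = modulus (real_scalar d ^+ n : K).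
  elim: n {x1 dA F FF F0 A Al Ac x} => [|n IH]; first by rewrite (modulus_natr 1).
  by rewrite !exprS modulusM -IH modulus_real_scalar // ltW.
rewrite mulrC -modulusM -multilinearZ //.
have xd i : `|real_scalar d *: x i| <= real_scalar d :> K.
  rewrite normrZ -[leRHS]mulr1; apply: ler_pM => //.
  by rewrite norm_modulus modulus_real_scalar // ltW.
have := dA _ xd; rewrite distrC norm_modulus -real_scalar1 ler_real_scalar => A1.
by rewrite -[A _](addrNK (A (cst 0))) addrC (le_trans (modulusD _ _)) // lerD2l.
Qed.

Lemma modulus_le_form_norm n (A : ('I_n -> E) -> K) x : cont_forms E n A ->
  (forall i, `|x i| <= 1) -> modulus (A x) <= form_norm A.
Proof.
by move=> Ac x1; apply: ub_le_sup; [exact: cont_form_bounded|exists x].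
Qed.

Lemma form_norm_le n (A : ('I_n -> E) -> K) (c : R) :
  (forall x, (forall i, `|x i| <= 1) -> modulus (A x) <= c) ->
  form_norm A <= c.
Proof.
move=> Ac; apply: ge_sup; last by move=> _ [x /= x1 <-]; exact: Ac.
by exists (modulus (A (cst 0))); exists (cst 0) => //= i; rewrite normr0.
Qed.

Lemma form_norm_ge0 n (A : ('I_n -> E) -> K) : cont_forms E n A ->
  0 <= form_norm A.
Proof.
move=> Ac; apply: (le_trans (modulus_ge0 (A (cst 0)))).
by apply: modulus_le_form_norm => // i; rewrite normr0.
Qed.

(** * Functionals as forms in one variable, and the weak norm *)

Lemma cont_forms_functional (phi : E -> K) :
  linear (phi : E -> K^o) -> continuous phi ->
  cont_forms E 1 (fun x => phi (x ord0)).
Proof.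
move=> lphi cphi; split=> [x i c u v|x].
  by rewrite !(ord1 i) !dfwithin lphi.
apply: (@continuous_comp {ptws 'I_1 -> E} E K (fun x => x ord0)); last exact: cphi.
exact: (@proj_continuous _ (fun=> E) ord0).
Qed.

Lemma form_norm_functional (phi : E -> K) :
  form_norm (fun x : 'I_1 -> E => phi (x ord0)) = dual_norm phi.
Proof.
congr sup; rewrite eqEsubset; split=> _ [x /= x1 <-].
  by exists (x ord0).
by exists (fun=> x).
Qed.

Lemma modulus_functional (phi : E -> K) (y : E) :
  linear (phi : E -> K^o) -> continuous phi ->
  modulus (phi y) <= dual_norm phi * modulus (`|y| : K).
Proof.
move=> lphi cphi; have cf := cont_forms_functional lphi cphi.
have Z (c : K) v : phi (c *: v) = c * phi v.
  by have := multilinearZ c (fun=> v) cf.1; rewrite expr1.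
have [->|y0] := eqVneq y 0.
  by rewrite -(scale0r (0 : E)) Z scale0r normr0 mul0r modulus0 mulr0.
pose u := `|y|^-1 *: y.
have {1}-> : y = `|y| *: u by rewrite scalerA mulfV ?normr_eq0// scale1r.
rewrite Z modulusM mulrC ler_wpM2r ?modulus_ge0 // -form_norm_functional.
apply: (modulus_le_form_norm (x := fun=> u) cf) => _.
by rewrite normrZ normrV ?unitfE ?normr_eq0// normr_id mulVf ?normr_eq0.
Qed.

(** The supremum is a genuine one: on the dual ball each value at [x j] is at most the norm of
    [x j], so the l_p norm of these norms is an upper bound. *)
Lemma weak_norm_ub (p : R) m (x : 'I_m -> E) (phi : E -> K) : 0 < p ->
  dual_ball phi -> lp_norm p (fun j => phi (x j)) <= weak_norm p x.
Proof.
move=> p0 phi1; apply: ub_le_sup; last by exists phi.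
exists (lp_norm p (fun j => `|x j| : K)) => _ [psi [psil psic psi1] <-].
rewrite /lp_norm ge0_ler_powR ?nnegrE ?invr_ge0 ?(ltW p0) //.
- by apply: sumr_ge0 => j _; exact: powR_ge0.
- by apply: sumr_ge0 => j _; exact: powR_ge0.
apply: ler_sum => j _; rewrite ge0_ler_powR ?nnegrE ?modulus_ge0 ?(ltW p0) //.
apply: (le_trans (modulus_functional _ psil psic)).
by rewrite ler_piMl ?modulus_ge0.
Qed.

Lemma weak_norm_ge0 (p : R) m (x : 'I_m -> E) : 0 < p -> 0 <= weak_norm p x.
Proof.
move=> p0; apply: (le_trans (lp_norm_ge0 p (fun j => 0 : K))).
apply: (@weak_norm_ub p m x (fun=> 0) p0); split.
- by move=> c u v; rewrite scaler0 addr0.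
- by move=> u; exact: cvg_cst.
apply: ge_sup => [|_ [y _ <-]]; last by rewrite modulus0.
by exists (modulus (0 : K)); exists 0; rewrite /= ?normr0.
Qed.

(** * Linear combinations of forms *)

Lemma continuous_lincomb (T : topologicalType) (I : Type) (e : seq I)
    (c : I -> K) (f : I -> T -> K) :
  (forall k, continuous (f k)) ->
  continuous (fun t => \sum_(k <- e) c k * f k t).
Proof.
move=> fc t; elim: e => [|k e IH]; rewrite /continuous_at.
  by under eq_fun do rewrite big_nil; rewrite big_nil; exact: cvg_cst.
under eq_fun do rewrite big_cons; rewrite big_cons.
by apply: cvgD IH; apply: cvgM; [exact: cvg_cst|exact: fc].
Qed.

Lemma cont_forms_sum n (I : Type) (e : seq I) (c : I -> K)
    (A : I -> ('I_n -> E) -> K) :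
  (forall k, cont_forms E n (A k)) ->
  cont_forms E n (fun y => \sum_(k <- e) c k * A k y).
Proof.
move=> Ac; split=> [x i a u v|x].
  rewrite scaler_sumr -big_split; apply: eq_bigr => k _ /=.
  by rewrite (Ac k).1 mulrDr scalerAr.
exact: (@continuous_lincomb {ptws 'I_n -> E} _ e c A (fun k => (Ac k).2)).
Qed.

(** * Concatenation of arguments, and forms with one block of variables frozen *)

Definition glue m n (z : 'I_m -> E) (y : 'I_n -> E) : 'I_(m + n) -> E :=
  fun i => match fintype.split i with inl j => z j | inr j => y j end.

Lemma glue_lshift m n (z : 'I_m -> E) (y : 'I_n -> E) j :
  glue z y (lshift n j) = z j.
Proof. by rewrite /glue -[lshift n j]/(unsplit (inl j)) unsplitK. Qed.

Lemma glue_rshift m n (z : 'I_m -> E) (y : 'I_n -> E) j :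
  glue z y (rshift m j) = y j.
Proof. by rewrite /glue -[rshift m j]/(unsplit (inr j)) unsplitK. Qed.

Lemma glue_dfwithl m n (z : 'I_m -> E) (y : 'I_n -> E) i u :
  glue (dfwith z i u) y = dfwith (glue z y) (lshift n i) u.
Proof.
apply/funext => j; have [k ->|k ->] := split_ordP j.
  rewrite glue_lshift; have [<-|ik] := eqVneq i k; first by rewrite !dfwithin.
  by rewrite !dfwithout ?eq_lshift// glue_lshift.
by rewrite dfwithout ?eq_lrshift// !glue_rshift.
Qed.

Lemma glue_dfwithr m n (z : 'I_m -> E) (y : 'I_n -> E) i u :
  glue z (dfwith y i u) = dfwith (glue z y) (rshift m i) u.
Proof.
apply/funext => j; have [k ->|k ->] := split_ordP j.
  by rewrite dfwithout ?eq_rlshift// !glue_lshift.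
rewrite glue_rshift; have [<-|ik] := eqVneq i k; first by rewrite !dfwithin.
by rewrite !dfwithout ?eq_rshift// glue_rshift.
Qed.

Lemma continuous_gluel m n (y : 'I_n -> E) :
  continuous (fun z : {ptws 'I_m -> E} => (glue z y : {ptws 'I_(m + n) -> E})).
Proof.
apply: continuous_ptws => i; rewrite /glue; case: fintype.split => j.
  exact: (@proj_continuous _ (fun=> E) j).
exact: (@cst_continuous {ptws 'I_m -> E} E (y j)).
Qed.

Lemma continuous_gluer m n (z : 'I_m -> E) :
  continuous (fun y : {ptws 'I_n -> E} => (glue z y : {ptws 'I_(m + n) -> E})).
Proof.
apply: continuous_ptws => i; rewrite /glue; case: fintype.split => j.
  exact: (@cst_continuous {ptws 'I_n -> E} E (z j)).
exact: (@proj_continuous _ (fun=> E) j).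
Qed.

Lemma cont_forms_gluel m n (A : ('I_(m + n) -> E) -> K) (y : 'I_n -> E) :
  cont_forms E (m + n) A -> cont_forms E m (fun z => A (glue z y)).
Proof.
move=> [Al Ac]; split=> [x i c u v|]; first by rewrite !glue_dfwithl Al.
move=> z; apply: (@continuous_comp {ptws 'I_m -> E} {ptws 'I_(m + n) -> E} K
  (fun z => glue z y) A); last exact: Ac.
exact: continuous_gluel.
Qed.

Lemma cont_forms_gluer m n (A : ('I_(m + n) -> E) -> K) (z : 'I_m -> E) :
  cont_forms E (m + n) A -> cont_forms E n (fun y => A (glue z y)).
Proof.
move=> [Al Ac]; split=> [x i c u v|]; first by rewrite !glue_dfwithr Al.
move=> y; apply: (@continuous_comp {ptws 'I_n -> E} {ptws 'I_(m + n) -> E} K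
  (glue z) A); last exact: Ac.
exact: continuous_gluer.
Qed.

Lemma form_norm_gluel m n (A : ('I_(m + n) -> E) -> K) (y : 'I_n -> E) :
  cont_forms E (m + n) A -> (forall i, `|y i| <= 1) ->
  form_norm (fun z => A (glue z y)) <= form_norm A.
Proof.
move=> Ac y1; apply: form_norm_le => z z1; apply: modulus_le_form_norm => // i.
by rewrite /glue; case: fintype.split.
Qed.

End Forms.

(** * Orthogonality of signs *)

Section Signs.
Local Set Implicit Arguments.
Local Unset Strict Implicit.

(** For [j != k], flipping the sign at [j] permutes the sign vectors and negates every term, so the
    sum equals its opposite. For [j = k] every term is 1. *)
Lemma sum_signs (K : numFieldType) m (j k : 'I_m) :
  \sum_(e : {ffun 'I_m -> bool}) (-1) ^+ e j * (-1) ^+ e k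
    = (if j == k then #|{ffun 'I_m -> bool}|%:R else 0) :> K.
Proof.
have [->|jk] := eqVneq j k.
  rewrite -[RHS]mulr_natr mul1r -sum1_card natr_sum; apply: eq_bigr => e _.
  by rewrite -expr2 sqrr_sign.
pose flip (e : {ffun 'I_m -> bool}) := [ffun i => (i == j) (+) e i].
have flipK : involutive flip.
  by move=> e; apply/ffunP => i; rewrite !ffunE addbA addbb.
set S := \sum_e _; suff : S = - S.
  by move/eqP; rewrite -addr_eq0 -mulr2n mulrn_eq0 /= => /eqP.
rewrite [LHS](reindex_inj (inv_inj flipK)) /= -sumrN; apply: eq_bigr => e _.
by rewrite !ffunE eqxx [k == j]eq_sym (negbTE jk) /= signrN mulNr.
Qed.

End Signs.

(** * Coincidence with constants, and its propagation to higher degree *)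

Section Coincidence.
Local Set Implicit Arguments.
Local Unset Strict Implicit.
Context {R : realType} {s : scalars} (E : completeNormedModType (scalar_field R s)).
Local Notation K := (scalar_field R s).

(** The equality of spaces and the norm bound merged into one inequality free of infima. The next
    two lemmas give the passage in both directions. *)
Definition forms_summing (n : nat) (p q c : R) : Prop :=
  forall A : ('I_n -> E) -> K, cont_forms E n A ->
  forall m (x : 'I_n -> 'I_m -> E),
    lp_norm p (fun j => A (fun i => x i j))
    <= c * form_norm A * \prod_(i < n) weak_norm q (x i).

Lemma forms_summing_of_summing_norm n (p q c : R) : 0 < q ->
  cont_forms E n = summing_forms E n p (fun=> q) ->
  (forall A, cont_forms E n A -> summing_norm p (fun=> q) A <= c * form_norm A) ->
  forms_summing n p q c.
Proof.
move=> q0 eqE le_c A Ac m x.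
have [_ [d dA]] : summing_forms E n p (fun=> q) A by rewrite -eqE.
have W0 : 0 <= \prod_(i < n) weak_norm q (x i).
  by apply: prodr_ge0 => i _; exact: weak_norm_ge0.
apply: (@le_trans _ _ (summing_norm p (fun=> q) A * \prod_(i < n) weak_norm q (x i)));
  last by rewrite ler_wpM2r // le_c.
(* The infimum is itself an admissible bound: if the product vanishes, any constant [d] already
   forces the left side to be 0; otherwise divide by the product and compare with every constant. *)
have [W00|Wneq] := eqVneq (\prod_(i < n) weak_norm q (x i)) 0.
  by have := dA.2 m x; rewrite W00 !mulr0.
have {}W0 : 0 < \prod_(i < n) weak_norm q (x i) by rewrite lt_def Wneq.
rewrite -ler_pdivrMr //; apply: lb_le_inf; first by exists d.
by move=> e [_ /(_ m x) eA]; rewrite ler_pdivrMr.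
Qed.

Lemma coincidence_of_forms_summing n (p q c : R) : 0 < q -> 0 <= c ->
  forms_summing n p q c ->
  cont_forms E n = summing_forms E n p (fun=> q) /\
  (forall A, cont_forms E n A -> summing_norm p (fun=> q) A <= c * form_norm A).
Proof.
move=> q0 c0 cE.
(* Summing constants are strictly positive, while [c * form_norm A] may be 0; hence the slack [e],
   arbitrarily small in the norm bound. *)
have inE A e : cont_forms E n A -> 0 < e ->
    summing_consts p (fun=> q) A (c * form_norm A + e).
  move=> Ac e0; split=> [|m x].
    by rewrite ltr_wpDl // mulr_ge0 // form_norm_ge0.
  apply: (le_trans (cE A Ac m x)); rewrite ler_wpM2r ?lerDl ?(ltW e0) //.
  by apply: prodr_ge0 => i _; exact: weak_norm_ge0.
split=> [|A Ac].
  rewrite eqEsubset; split=> [A Ac|A []//]; split=> //.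
  by exists (c * form_norm A + 1); exact: inE.
apply/ler_addgt0Pr => e e0; apply: ge_inf; last exact: inE.
by exists 0 => d [/ltW].
Qed.

Lemma forms_summing_linear (r : R) : 0 < r -> forms_summing 1 r r 1.
Proof.
move=> r0 A [Al Ac] m x; rewrite mul1r big_ord1.
pose phi (y : E) := A (fun=> y).
have phiE (y : 'I_1 -> E) : A y = phi (y ord0).
  by congr A; apply/funext => i; rewrite (ord1 i).
have lphi : linear (phi : E -> K^o).
  move=> c u v; have dE w : dfwith (fun=> 0) (ord0 : 'I_1) w = (fun=> w) :> ('I_1 -> E).
    by apply/funext => i; rewrite (ord1 i) dfwithin.
  by have := Al (fun=> 0) ord0 c u v; rewrite !dE.
have cphi : continuous phi.
  move=> y; apply: (@continuous_comp E {ptws 'I_1 -> E} K (fun u _ => u)); last exact: Ac.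
  by apply: continuous_ptws => _ t; exact: cvg_id.
have -> : form_norm A = dual_norm phi.
  by rewrite -form_norm_functional; congr form_norm; apply/funext.
under [X in lp_norm _ X]eq_fun do rewrite phiE.
have cphi1 := cont_forms_functional lphi cphi.
set N := dual_norm phi; have N0 : 0 <= N.
  by rewrite /N -form_norm_functional; exact: form_norm_ge0.
(* If [N = 0] then [phi] vanishes; otherwise [psi = phi / N] lies in the dual ball and the weak norm
   bounds it. *)
have [N00|Nneq] := eqVneq N 0.
  rewrite N00 mul0r lp_norm_le_sum // big1 ?powR_ge0 // => j _.
  have := modulus_functional (x ord0 j) lphi cphi; rewrite -/N N00 mul0r => le0.
  have /eqP -> : modulus (phi (x ord0 j)) == 0 by rewrite eq_le le0 modulus_ge0.
  by rewrite powR0 // gt_eqF.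
pose psi y : K := real_scalar N^-1 * phi y.
have psiM y : phi y = real_scalar N * psi y.
  by rewrite mulrA -real_scalarM mulfV // real_scalar1 mul1r.
under [X in lp_norm _ X]eq_fun do rewrite psiM.
rewrite lp_normZ // modulus_real_scalar // ler_wpM2l //.
apply: (@weak_norm_ub _ _ _ _ _ _ psi) => //; split.
- by move=> c u v; rewrite /psi lphi mulrDr scalerAr.
- by move=> y; apply: cvgM; [exact: cvg_cst|exact: cphi].
apply: ge_sup => [|_ [y /= y1 <-]].
  by exists (modulus (psi 0)); exists 0; rewrite /= ?normr0.
rewrite modulusM modulus_real_scalar ?invr_ge0 // ler_pdivrMl ?lt_def ?Nneq //.
rewrite mulr1 /N -form_norm_functional.
exact: (modulus_le_form_norm (x := fun=> y) cphi1).
Qed.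

Lemma forms_summing_step n (p q a b : R) : 1 <= p -> 0 < q -> 0 <= a -> 0 <= b ->
  forms_summing n p q a -> forms_summing 2 1 q b ->
  forms_summing (2 + n) p q (a * b).
Proof.
move=> p1 q0 a0 b0 an b2 A Ac m x.
have p0 : 0 < p by exact: lt_le_trans p1.
pose z k := fun i : 'I_2 => x (lshift n i) k.
pose v j := fun i : 'I_n => x (rshift 2 i) j.
pose W2 := \prod_(i < 2) weak_norm q (x (lshift n i)).
pose Wn := \prod_(i < n) weak_norm q (x (rshift 2 i)).
have W20 : 0 <= W2 by apply: prodr_ge0 => i _; exact: weak_norm_ge0.
have Wn0 : 0 <= Wn by apply: prodr_ge0 => i _; exact: weak_norm_ge0.
rewrite big_split_ord -/W2 -/Wn /=.
have xE j : (fun i => x i j) = glue (z j) (v j).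
  by apply/funext => i; have [k ->|k ->] := split_ordP i;
    rewrite ?glue_lshift ?glue_rshift.
pose B (e : {ffun 'I_m -> bool}) (y : 'I_n -> E) : K :=
  \sum_k (-1) ^+ e k * A (glue (z k) y).
have Bc e : cont_forms E n (B e).
  by apply: cont_forms_sum => k; exact: cont_forms_gluer.
(* The triangle inequality erases the signs and leaves an l_1 norm over [k]; this is where
   summability with exponent exactly 1 enters. *)
have B_le e : form_norm (B e) <= b * form_norm A * W2.
  apply: form_norm_le => y y1; apply: (le_trans (modulus_sum _ _ _)).
  have := b2 _ (cont_forms_gluel y Ac) m (fun i => x (lshift n i)).
  rewrite lp_norm1 => le2.
  under eq_bigr do rewrite modulusM modulus_sign mul1r.
  apply: (le_trans le2).
  by rewrite -/W2 ler_wpM2r // ler_wpM2l // form_norm_gluel.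
(* The bound is the same for every sign vector, so averaging over [e] costs no constant. *)
pose M := a * (b * form_norm A * W2) * Wn.
have M0 : 0 <= M by rewrite !mulr_ge0 // form_norm_ge0.
have -> : a * b * form_norm A * (W2 * Wn) = M by rewrite /M; ring.
have B_sum e : \sum_j modulus (B e (v j)) `^ p <= M `^ p.
  rewrite -lp_norm_le_sum //; apply: (le_trans (an _ (Bc e) m _)).
  by rewrite -/Wn ler_wpM2r // ler_wpM2l.
pose N := #|{ffun 'I_m -> bool}|.
have N0 : 0 < N%:R :> R by rewrite ltr0n /N card_ffun card_bool expn_gt0.
have avg j : N%:R * A (fun i => x i j) =
      \sum_(e : {ffun 'I_m -> bool}) (-1) ^+ e j * B e (v j).
  (* After the exchange, orthogonality kills every index [k] except [j]. *)
  under eq_bigr do rewrite mulr_sumr; rewrite exchange_big /= (bigD1 j) //=.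
  under eq_bigr do rewrite mulrA.
  rewrite -mulr_suml sum_signs eqxx big1 ?addr0 -?xE // => k kj.
  under eq_bigr do rewrite mulrA.
  by rewrite -mulr_suml sum_signs eq_sym (negbTE kj) mul0r.
have A_le j : modulus (A (fun i => x i j)) `^ p
    <= (\sum_e modulus (B e (v j)) `^ p) / N%:R.
  have := @power_mean R p _ (enum {ffun 'I_m -> bool})
    (fun e => modulus (B e (v j))) p1 (fun=> modulus_ge0 _).
  rewrite !big_enum -cardT -/N; apply: le_trans.
  rewrite ge0_ler_powR ?nnegrE ?modulus_ge0 ?(ltW p0) //.
    by rewrite divr_ge0 ?(ltW N0) ?sumr_ge0// => e _; exact: modulus_ge0.
  rewrite ler_pdivlMr // mulrC -(modulus_natr (s := s)) -modulusM avg.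
  apply: (le_trans (modulus_sum _ _ _)); apply: ler_sum => e _.
  by rewrite modulusM modulus_sign mul1r.
rewrite lp_norm_le_sum //; apply: (le_trans (ler_sum _ (fun j _ => A_le j))).
(* With the sum over [e] outside, each of the [N] sign vectors contributes at most [M] to the power
   [p], which cancels the division by [N]. *)
rewrite -mulr_suml exchange_big /= ler_pdivrMr //.
apply: (le_trans (ler_sum _ (fun e _ => B_sum e))).
by rewrite sumr_const -/N mulr_natr.
Qed.

(** Each added pair of variables costs one factor [b]; [k.+1.*2 + n] converts to
    [2 + (k.*2 + n)]. *)
Lemma forms_summing_iter n (p q a b : R) k :
  1 <= p -> 0 < q -> 0 <= a -> 0 <= b ->
  forms_summing n p q a -> forms_summing 2 1 q b ->
  forms_summing (k.*2 + n) p q (b ^+ k * a).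
Proof.
move=> p1 q0 a0 b0 an b2; elim: k => [|k IH]; first by rewrite mul1r.
rewrite exprSr mulrAC; apply: (forms_summing_step p1 q0 _ b0 IH b2).
by rewrite mulr_ge0 ?exprn_ge0.
Qed.

End Coincidence.

Theorem theorem5p3 (R : realType) (s : scalars) (r : R)
    (E : completeNormedModType (scalar_field R s)) (C : R) :
  1 <= r -> r <= 2 -> 0 < C ->
  cont_forms E 2 = summing_forms E 2 1 (fun=> r) ->
  (forall A, cont_forms E 2 A ->
     summing_norm 1 (fun=> r) A <= C * form_norm A) ->
  (forall n : nat, (0 < n)%N -> ~~ odd n ->
     cont_forms E n = summing_forms E n 1 (fun=> r) /\
     (forall A, cont_forms E n A ->
        summing_norm 1 (fun=> r) A <= C ^+ (n %/ 2) * form_norm A)) /\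
  (forall n : nat, (3 <= n)%N -> odd n ->
     cont_forms E n = summing_forms E n r (fun=> r) /\
     (forall A, cont_forms E n A ->
        summing_norm r (fun=> r) A <= C ^+ ((n - 1) %/ 2) * form_norm A)).
Proof.
move=> r1 _ C0 eqE leC; have r0 : 0 < r by exact: lt_le_trans r1.
have E2 := forms_summing_of_summing_norm r0 eqE leC.
have C0' := ltW C0.
split=> n n0 on; apply: coincidence_of_forms_summing; rewrite ?exprn_ge0 //.
  (* Even degrees start at 2 with constant [C], so [n./2 = k.+1] needs only [k] iterations and gives
     [C ^+ k * C]. Positivity of [n] excludes [n./2 = 0]. *)
  have nE : n = n./2.*2 by rewrite even_halfK.
  rewrite divn2; case: n./2 nE => [n00|k ->]; first by rewrite n00 in n0.
  by rewrite exprSr doubleS -addn2; exact: forms_summing_iter.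
(* Odd degrees start at 1 with constant 1 and take [n./2] iterations with exponent [p = r], for
   which [1 <= r] gives the power mean inequality. *)
have nE : n = (n./2.*2 + 1)%N by rewrite -{1}(odd_double_half n) on addnC.
have -> : ((n - 1) %/ 2 = n./2)%N by rewrite divn2 {1}nE addnK doubleK.
rewrite {1}nE -[_ ^+ _]mulr1; apply: forms_summing_iter => //.
exact: forms_summing_linear.
Qed.
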